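(* Let $w_1,\dots,w_n$ be positive real numbers and let $H_{\mathfrak W}=\prod_{k=1}^n\{0,w_k\}\subseteq\mathbb R^n$. Suppose that $X=\{\boldsymbol x_0,\boldsymbol x_1,\dots,\boldsymbol x_m\}\subseteq H_{\mathfrak W}$ is a set with at least two points, equipped with the $\ell^1$ metric. Then $$\mathrm{rank}(D_X)=\dim\bigl(\mathrm{span}(\boldsymbol x_1-\boldsymbol x_0,\dots,\boldsymbol x_m-\boldsymbol x_0)\bigr)+1 .$$
   Context: The points $\boldsymbol x_0,\dots,\boldsymbol x_m$ are distinct, and $D_X=(\|\boldsymbol x_i-\boldsymbol x_j\|_1)_{i,j=0}^m$ is the distance matrix of $X$. *)

(* Defs.v *)
From HB Require Import structures.
From mathcomp Require Import all_boot all_order all_algebra.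
From mathcomp Require Import reals.

Set Implicit Arguments.
Unset Strict Implicit.
Unset Printing Implicit Defensive.

Import Order.TTheory GRing.Theory Num.Theory.
Local Open Scope ring_scope.

Definition weighted_cube (R : realType) (n : nat) (w : 'I_n -> R) :
    {pred 'rV[R]_n} :=
  [pred x : 'rV[R]_n | [forall k, x 0 k \in [:: 0; w k]]].

(* The norm that MathComp-Analysis puts on matrices is the sup norm, hence
   this separate definition. *)
Definition l1norm (R : realType) (n : nat) (v : 'rV[R]_n) : R :=
  \sum_(k < n) `|v 0 k|.

Definition distance_matrix (R : realType) (m n : nat)
    (x : 'I_m.+1 -> 'rV[R]_n) : 'M[R]_m.+1 :=
  \matrix_(i, j) l1norm (x i - x j).

(* Main.v *)
Require Import Defs.
From HB Require Import structures.
From mathcomp Require Import all_boot all_order all_algebra.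
From mathcomp Require Import reals.
From mathcomp Require Import ring.

Set Implicit Arguments.
Unset Strict Implicit.
Unset Printing Implicit Defensive.

Import Order.TTheory GRing.Theory Num.Theory.
Local Open Scope ring_scope.

(** On a cube, the l1 distance is linear algebra in disguise.  Put the origin at
    x_0: let Y be the matrix with rows y_i = x_i - x_0.  If a and b both lie in
    {0, w}, then |a - b| = (a - b)^2 / w, so expanding the square coordinatewise
    gives
      D = q 1^T + 1 q^T - 2 Y G Y^T,   G = diag (1 / w_k),
    where q_i is the distance from x_i to x_0.  Moreover the k-th coordinate of
    x_i - x_0 has a sign that depends only on x_0, so q = Y s for a fixed sign
    vector s ([distance_matrix_decomposition], [distance_matrix_col0]).

    The two sides are then compared through left kernels
    ([distance_matrix_ker]): u D = 0 if and only if u Y = 0 and u 1 = 0.  The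
    converse implication is immediate from the formula since u q = u Y s.  For
    the direct one, column 0 of D is q, hence u q = 0; what remains of u D = 0
    is (u 1) q^T = 2 u Y G Y^T, and multiplying by u^T on the right kills the
    left-hand side and leaves (u Y) G (u Y)^T = 0.  As G is positive definite,
    u Y = 0; then (u 1) q = 0, and q is nonzero because some point differs from
    x_0.

    Thus D has the rank of the block matrix [Y | 1].  Row 0 of Y vanishes, so
    the column 1 is independent of the columns of Y and this rank is rank Y + 1
    ([mxrank_row_mx_const1]), while rank Y is the dimension of the span of the
    differences ([dim_span_displacements]). *)

Lemma mem_span_rows (F : fieldType) (m n : nat) (A : 'M[F]_(m, n)) (v : 'rV[F]_n) :
  (v \in <<[seq row i A | i : 'I_m]>>%VS) = (v <= A)%MS.
Proof.
apply/idP/idP => [v_span | /submxP[u ->]].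
  rewrite (coord_span (X := in_tuple _) v_span).
  apply: summx_sub => i _; apply: scalemx_sub.
  have /mapP[j _ ->] : (in_tuple [seq row j A | j : 'I_m])`_i
      \in [seq row j A | j : 'I_m] by rewrite mem_nth.
  exact: row_sub.
rewrite mulmx_sum_row; apply: memv_suml => i _; apply: memvZ.
exact: memv_span (image_f _ _).
Qed.

(** The rows of [row_base A] are a free family spanning the same subspace, so
    both dimensions count them. *)
Lemma dim_span_rows (F : fieldType) (m n : nat) (A : 'M[F]_(m, n)) :
  \dim <<[seq row i A | i : 'I_m]>>%VS = \rank A.
Proof.
pose b := [tuple row i (row_base A) | i < \rank A].
have b_free : free b.
  apply/freeP => k sum0 i.
  have /eqP : (\row_j k j) *m row_base A = 0.
    rewrite mulmx_sum_row -[RHS]sum0; apply: eq_bigr => j _.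
    by rewrite mxE (nth_map j) ?size_enum_ord // nth_ord_enum.
  rewrite (mulmx_free_eq0 _ (row_base_free A)) => /eqP/rowP/(_ i).
  by rewrite !mxE.
suff -> : <<[seq row i A | i : 'I_m]>>%VS = <<b>>%VS.
  by rewrite (eqP b_free) size_tuple.
have bE : b = [seq row i (row_base A) | i : 'I_(\rank A)] :> seq _ by [].
by apply/vspaceP => v; rewrite bE !mem_span_rows eq_row_base.
Qed.

(** Every vector of the column space of [A] vanishes at [i0], and the constant
    column does not, so adjoining it raises the rank by exactly one. *)
Lemma mxrank_row_mx_const1 (F : fieldType) (m n : nat) (A : 'M[F]_(m.+1, n)) (i0 : 'I_m.+1) :
  row i0 A = 0 -> \rank (row_mx A (const_mx 1 : 'cV_m.+1)) = (\rank A + 1)%N.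
Proof.
move=> rowA0; rewrite -mxrank_tr tr_row_mx trmx_const -addsmxE.
rewrite mxrank_disjoint_sum ?mxrank_tr.
  rewrite rank_rV; case: eqP => // /rowP/(_ i0)/eqP.
  by rewrite !mxE oner_eq0.
apply/eqP/rowV0P => v; rewrite sub_capmx => /andP[/submxP[u ->]].
case/sub_rVP => c /[dup] eq_c /rowP/(_ i0).
have -> : (u *m A^T) 0 i0 = 0.
  rewrite mxE big1 // => k _.
  by move/rowP: rowA0 => /(_ k); rewrite !mxE => ->; rewrite mulr0.
by rewrite !mxE mulr1 eq_c => <-; rewrite scale0r.
Qed.

(** Rank-nullity: matrices with the same number of rows can be compared through
    their left kernels, whatever their widths. *)
Lemma mxrank_eq_ker (F : fieldType) (m p q : nat) (A : 'M[F]_(m, p)) (B : 'M[F]_(m, q)) :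
  (forall u : 'rV_m, (u *m A == 0) = (u *m B == 0)) -> \rank A = \rank B.
Proof.
move=> kerE; have : \rank (kermx A) = \rank (kermx B).
  by apply/eqmx_rank/andP; split; apply/rV_subP => u;
    rewrite !sub_kermx kerE.
rewrite !mxrank_ker => eq_sub.
by rewrite -(subKn (rank_leq_row A)) eq_sub subKn ?rank_leq_row.
Qed.


Definition displacement_mx (R : realType) (m n : nat)
    (x : 'I_m.+1 -> 'rV[R]_n) : 'M[R]_(m.+1, n) :=
  \matrix_i (x i - x ord0).

Definition inverse_weight_mx (R : realType) (n : nat) (w : 'I_n -> R) :
    'M[R]_n :=
  diag_mx (\row_k (w k)^-1).

(** The sign vector is 1 where [a] is 0 and -1 where [a] is [w k]: from [a], the
    other vertices of the cube can only be reached by going up, respectively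
    down, along axis [k].  The affine formula makes identities provable
    uniformly by field arithmetic. *)
Definition orientation (R : realType) (n : nat) (w : 'I_n -> R)
    (a : 'rV[R]_n) : 'cV[R]_n :=
  \col_k (1 - a 0 k / w k *+ 2).

Lemma row0_displacement_mx (R : realType) (m n : nat)
    (x : 'I_m.+1 -> 'rV[R]_n) :
  row ord0 (displacement_mx x) = 0.
Proof. by rewrite rowK subrr. Qed.

Lemma dim_span_displacements (R : realType) (m n : nat)
    (x : 'I_m.+1 -> 'rV[R]_n) :
  \dim <<[seq x (lift ord0 i) - x ord0 | i : 'I_m]>>%VS =
    \rank (displacement_mx x).
Proof.
have -> : [seq x (lift ord0 i) - x ord0 | i : 'I_m] =
          [seq row i (row' ord0 (displacement_mx x)) | i : 'I_m].
  by apply: eq_map => i; apply/rowP => k; rewrite !mxE.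
rewrite dim_span_rows; apply/eqmx_rank/andP; split; apply/row_subP => i.
  have -> : row i (row' ord0 (displacement_mx x)) =
            row (lift ord0 i) (displacement_mx x).
    by apply/rowP => k; rewrite !mxE.
  exact: row_sub.
case: (unliftP ord0 i) => [j|] ->; last by rewrite row0_displacement_mx sub0mx.
have -> : row (lift ord0 j) (displacement_mx x) =
          row j (row' ord0 (displacement_mx x)).
  by apply/rowP => k; rewrite !mxE.
exact: row_sub.
Qed.

Lemma weighted_cube_coord (R : realType) (n : nat) (w : 'I_n -> R)
    (a : 'rV[R]_n) (k : 'I_n) :
  a \in weighted_cube w -> a 0 k = 0 \/ a 0 k = w k.
Proof.
rewrite inE => /forallP/(_ k); rewrite !inE.
by case/orP => /eqP; [left | right].
Qed.

Lemma l1norm_eq0 (R : realType) (n : nat) (v : 'rV[R]_n) :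
  l1norm v = 0 -> v = 0.
Proof.
move/eqP; rewrite psumr_eq0 // => /allP v0; apply/rowP => k.
by have /eqP/normr0_eq0 := v0 k (mem_index_enum _); rewrite !mxE.
Qed.

(** Seen from one vertex of the cube, the l1 norm of a displacement is a linear
    form, since the sign of each coordinate is fixed by that vertex. *)
Lemma distance_matrix_col0 (R : realType) (m n : nat) (w : 'I_n -> R)
    (x : 'I_m.+1 -> 'rV[R]_n)
    (w_gt0 : forall k, 0 < w k)
    (x_cube : forall i, x i \in weighted_cube w) :
  col ord0 (distance_matrix x) = displacement_mx x *m orientation w (x ord0).
Proof.
apply/colP => i; rewrite !mxE; apply: eq_bigr => k _; rewrite !mxE.
have wkN0 := lt0r_neq0 (w_gt0 k); have w_norm := gtr0_norm (w_gt0 k).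
case: (weighted_cube_coord k (x_cube i)) => ->;
  case: (weighted_cube_coord k (x_cube ord0)) => ->;
  rewrite ?subr0 ?sub0r ?subrr ?normrN ?normr0 ?w_norm; by field.
Qed.

(** Polarization of |a - b| = (a - b)^2 / w, valid for a and b in {0, w}: with
    B = Y G Y^T, the distance is B_ii + B_jj - 2 B_ij, and B_ii = q_i. *)
Lemma distance_matrix_decomposition (R : realType) (m n : nat) (w : 'I_n -> R)
    (x : 'I_m.+1 -> 'rV[R]_n)
    (w_gt0 : forall k, 0 < w k)
    (x_cube : forall i, x i \in weighted_cube w) :
  let Y := displacement_mx x in
  let q := Y *m orientation w (x ord0) in
  distance_matrix x =
    q *m const_mx 1 + const_mx 1 *m q^T - (Y *m inverse_weight_mx w *m Y^T) *+ 2.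
Proof.
apply/matrixP => i j; rewrite !mxE !big_ord1 !mxE mulr1 mul1r.
rewrite -!big_split -sumrN -big_split /=.
apply: eq_bigr => k _; rewrite mul_mx_diag !mxE.
have wkN0 := lt0r_neq0 (w_gt0 k); have w_norm := gtr0_norm (w_gt0 k).
case: (weighted_cube_coord k (x_cube i)) => ->;
  case: (weighted_cube_coord k (x_cube j)) => ->;
  case: (weighted_cube_coord k (x_cube ord0)) => ->;
  rewrite ?subr0 ?sub0r ?subrr ?normrN ?normr0 ?w_norm; by field.
Qed.

Lemma inverse_weight_mx_definite (R : realType) (n : nat) (w : 'I_n -> R)
    (v : 'rV[R]_n) (w_gt0 : forall k, 0 < w k) :
  v *m inverse_weight_mx w *m v^T = 0 -> v = 0.
Proof.
move=> /matrixP/(_ 0 0)/eqP; rewrite [X in X == _]mxE [X in _ == X]mxE.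
rewrite psumr_eq0 => [/allP v0 | k _]; last first.
  by rewrite mul_mx_diag !mxE mulrAC -expr2 mulr_ge0 ?sqr_ge0 ?invr_ge0 ?ltW.
apply/rowP => k; have := v0 k (mem_index_enum _).
rewrite mul_mx_diag !mxE mulrAC mulf_eq0 invr_eq0 (gt_eqF (w_gt0 k)) orbF.
by rewrite mulf_eq0 orbb => /eqP.
Qed.

(** The passage from [D] to the block matrix rests on testing [u D] against
    [u^T], where positive definiteness of the Gram part forces [u Y = 0]. *)
Lemma distance_matrix_ker (R : realType) (m n : nat) (w : 'I_n -> R)
    (x : 'I_m.+1 -> 'rV[R]_n) (u : 'rV[R]_m.+1)
    (w_gt0 : forall k, 0 < w k)
    (two_points : (1 <= m)%N)
    (x_inj : injective x)
    (x_cube : forall i, x i \in weighted_cube w) :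
  (u *m distance_matrix x == 0) =
    (u *m row_mx (displacement_mx x) (const_mx 1 : 'cV_m.+1) == 0).
Proof.
have D0 := distance_matrix_col0 w_gt0 x_cube.
have := distance_matrix_decomposition w_gt0 x_cube; rewrite /=.
move: D0; set Y := displacement_mx x; set D := distance_matrix x.
move qE: (Y *m _) => q D0 DE; rewrite mul_mx_row row_mx_eq0.
apply/eqP/andP => [uD0 | [/eqP uY0 /eqP u1]]; last first.
  rewrite DE -qE mulr2n mulmxBr !mulmxDr !mulmxA uY0 u1 !mul0mx.
  by rewrite !addr0 subr0.
have uq0 : u *m q = 0 by rewrite -D0 colE mulmxA uD0 mul0mx.
have u1E : u *m const_mx 1 *m q^T = (u *m Y *m inverse_weight_mx w *m Y^T) *+ 2.
  apply/eqP; rewrite -subr_eq0 -uD0 DE !mulr2n mulmxBr !mulmxDr !mulmxA uq0.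
  by rewrite mul0mx add0r.
have uY0 : u *m Y = 0.
  apply: (inverse_weight_mx_definite w_gt0); apply/eqP.
  (* On the right, [u1E] times [u^T] is twice the quadratic form at [u Y]; on
     the left it contains the factor [q^T u^T = (u q)^T = 0]. *)
  have := congr1 (mulmxr u^T) u1E; rewrite /= -mulmxA -trmx_mul uq0 trmx0 mulmx0.
  move/eqP; rewrite eq_sym -scaler_nat -scalemxAl scaler_eq0 pnatr_eq0 /=.
  by rewrite trmx_mul mulmxA.
split; apply/eqP => //.
move: u1E; rewrite uY0 !mul0mx mul0rn [u *m const_mx 1]mx11_scalar mul_scalar_mx.
move/eqP; rewrite scaler_eq0 => /orP[/eqP-> | ]; first by rewrite raddf0.
(* If [q = 0], then [x i1] is at distance 0 from [x ord0]. *)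
pose i1 : 'I_m.+1 := lift ord0 (Ordinal two_points).
rewrite trmx_eq0 -D0 => /eqP/colP/(_ i1); rewrite !mxE => /l1norm_eq0/eqP.
by rewrite subr_eq0 => /eqP/x_inj/eqP; rewrite eq_sym (negbTE (neq_lift _ _)).
Qed.

Theorem theorem6p11 (R : realType) (n m : nat) (w : 'I_n -> R)
    (x : 'I_m.+1 -> 'rV[R]_n)
    (w_gt0 : forall k, 0 < w k)
    (two_points : (1 <= m)%N)
    (x_inj : injective x)
    (x_cube : forall i, x i \in weighted_cube w) :
  \rank (distance_matrix x) =
    (\dim <<[seq (x (lift ord0 i) - x ord0)%R | i : 'I_m]>>%VS + 1)%N.
Proof.
rewrite dim_span_displacements.
rewrite -(mxrank_row_mx_const1 (row0_displacement_mx x)).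
by apply: mxrank_eq_ker => u; apply: distance_matrix_ker.
Qed.
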